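(* Let $\mathrm{ch}:S(m)\to\widehat{R(m)}$ be the homomorphism defined by $q\mapsto e^{\hbar/2}$ and $A_p\mapsto e^{a_p}$. Then the diagram formed by $\mathcal D^U:\widetilde U^0_i\to S(m)$, $\mathrm{ch}:S(m)\to\widehat{R(m)}$, $\Phi^0:\widetilde U^0_i\to\widehat{Y^0_i}$ and $\mathcal D^Y:\widehat{Y^0_i}\to\widehat{R(m)}$ commutes, that is, $$\mathrm{ch}\circ\mathcal D^U=\mathcal D^Y\circ\Phi^0 .$$
   Context: $\mathfrak g$ is a complex semisimple Lie algebra with simple roots $\{\alpha_i\}_{i\in\mathbf I}$ and non-degenerate invariant form $(\cdot,\cdot)$; $d_i=(\alpha_i,\alpha_i)/2$; $\hbar$ is formal, $q=e^{\hbar/2}$, $q_i=q^{d_i}=e^{\hbar d_i/2}$. Fix $i\in\mathbf I$ and an integer $m\ge1$. $\widetilde U^0_i$ is the polynomial ring on generators $\{H_{i,r}\}_{r\in\mathbb Z}$, and $\psi_i(z)=\exp(\frac{\hbar d_i}{2}H_{i,0})\exp((q_i-q_i^{-1})\sum_{s\ge1}H_{i,s}z^{-s})$, $\phi_i(z)=\exp(-\frac{\hbar d_i}{2}H_{i,0})\exp(-(q_i-q_i^{-1})\sum_{s\ge1}H_{i,-s}z^{s})$. $Y^0_i$ is the polynomial algebra over $\mathbb C[\hbar]$ on $\{\xi_{i,r}\}_{r\in\mathbb N}$ (the corresponding commutative subalgebra of the Yangian $Y_\hbar(\mathfrak g)$), graded by $\deg\xi_{i,r}=r$, $\deg\hbar=1$,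 with graded completion $\widehat{Y^0_i}$. Set $\xi_i(u)=1+\hbar\sum_{r\ge0}\xi_{i,r}u^{-r-1}$ and define $t_{i,r}\in Y^0_i$ by $\hbar\sum_{r\ge0}t_{i,r}u^{-r-1}=\log\xi_i(u)$. $\Phi^0:\widetilde U^0_i\to\widehat{Y^0_i}$ is given by $\Phi^0(H_{i,0})=d_i^{-1}t_{i,0}$ and $\Phi^0(H_{i,r})=\frac{\hbar}{q_i-q_i^{-1}}\sum_{k\ge0}t_{i,k}\frac{r^k}{k!}$ for $r\in\mathbb Z\setminus\{0\}$. $S(m)=\mathbb C[q^{\pm1},A_1^{\pm1},\dots,A_m^{\pm1}]^{\mathfrak S_m}$, $R(m)=\mathbb C[\hbar,a_1,\dots,a_m]^{\mathfrak S_m}$, and $\widehat{R(m)}$ is the completion of $R(m)$ with respect to the grading $\deg\hbar=\deg a_p=1$. $\mathcal D^U:\widetilde U^0_i\to S(m)$ is defined by $\mathcal D^U(\psi_i(z))=\prod_{p=1}^m\frac{q_iz-q_i^{-1}A_p}{z-A_p}=\mathcal D^U(\phi_i(z))$, the middle term being expanded in powers of $z^{-1}$ and $z$ respectively; explicitly $\mathcal D^U(H_{i,0})=m$ and $\mathcal D^U((q_i-q_i^{-1})H_{i,r})=\frac{1-q_i^{-2r}}{r}\sum_{p=1}^mA_p^r$ for $r\neq0$. $\mathcal D^Y:Y^0_i\to R(m)$ is the $\mathbb C[\hbar]$-algebra homomorphism defined by $\mathcal D^Y(\xi_i(u))=\prod_{p=1}^m\frac{u+d_i\hbar-a_p}{u-a_p}$;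 it preserves the grading and is extended to completions. (These give the highest weights of modules with Drinfeld polynomials with roots $A_p$, resp. $a_p$.) *)

(* Defs.v *)
From HB Require Import structures.
From mathcomp Require Import all_boot all_order all_algebra all_fingroup.
From mathcomp Require Import finmap.
From mathcomp.classical Require Import boolp.
From mathcomp Require Import reals complex.
(* monalg and mpoly declare the same notations. *)
From mathcomp.multinomials Require Import -(notations) monalg.
From mathcomp.multinomials Require Import mpoly.

Set Implicit Arguments.
Unset Strict Implicit.
Unset Printing Implicit Defensive.

Import GRing.Theory.
Local Open Scope ring_scope.

Record lieAlgebra (F : fieldType) := LieAlgebra {
  lie_sort :> vectType F;
  bracket : lie_sort -> lie_sort -> lie_sort;
  bracketDl : forall a x y z,
    bracket (a *: x + y) z = a *: bracket x z + bracket y z;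
  bracketDr : forall a x y z,
    bracket z (a *: x + y) = a *: bracket z x + bracket z y;
  bracketxx : forall x, bracket x x = 0;
  jacobi : forall x y z, bracket x (bracket y z) + bracket y (bracket z x)
                           + bracket z (bracket x y) = 0 }.

Section Semisimple.
Variables (F : fieldType) (L : lieAlgebra F).
Local Notation "[[ x , y ]]" := (bracket x y).

Definition bracketv (U V : {vspace L}) : {vspace L} :=
  <<[seq [[x, y]] | x <- vbasis U, y <- vbasis V]>>%VS.

Definition lie_ideal (V : {vspace L}) :=
  forall x y, y \in V -> [[x, y]] \in V.

Definition lie_solvable (V : {vspace L}) :=
  exists n, iter n (fun U => bracketv U U) V = 0%VS.

Definition lie_nilpotent (V : {vspace L}) :=
  exists n, iter n (bracketv V) V = 0%VS.

Definition semisimple :=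
  forall V, lie_ideal V -> lie_solvable V -> V = 0%VS.

Definition cartan_subalgebra (H : {vspace L}) :=
  [/\ forall x y, x \in H -> y \in H -> [[x, y]] \in H,
      lie_nilpotent H
    & forall x, (forall h, h \in H -> [[x, h]] \in H) -> x \in H].

Definition is_root (H : {vspace L}) (alpha : 'Hom(subvs_of H, F^o)) :=
  alpha <> 0 /\
  exists2 x : L, x <> 0 & forall h, [[vsval h, x]] = alpha h *: x.

Definition simple_roots (H : {vspace L}) (I : finType)
    (Delta : I -> 'Hom(subvs_of H, F^o)) :=
  [/\ forall i, is_root (Delta i),
      free [seq Delta i | i <- enum I]
    & forall beta, is_root beta ->
        exists n : I -> nat,
          beta = \sum_i (n i)%:R *: Delta i \/
          beta = - (\sum_i (n i)%:R *: Delta i)].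

Definition invariant_form (B : L -> L -> F) :=
  [/\ forall a x y z, B (a *: x + y) z = a * B x z + B y z,
      forall x y, B x y = B y x,
      forall x y z, B [[x, y]] z = B x [[y, z]]
    & forall x, (forall y, B x y = 0) -> x = 0].

(* (alpha, alpha) / 2 = c, the form being carried to the dual of H by the
   isomorphism t |-> B t _ from H to its dual. *)
Definition half_sqnorm (H : {vspace L}) (B : L -> L -> F)
    (alpha : 'Hom(subvs_of H, F^o)) (c : F) :=
  exists2 t : subvs_of H, (forall h, B (vsval t) (vsval h) = alpha h)
                        & c = B (vsval t) (vsval t) / 2%:R.

End Semisimple.

Record semisimpleData (F : fieldType) := SemisimpleData {
  sd_lie :> lieAlgebra F;
  sd_semisimple : semisimple sd_lie;
  sd_cartan : {vspace sd_lie};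
  sd_cartanP : cartan_subalgebra sd_cartan;
  sd_index : finType;
  sd_simple : sd_index -> 'Hom(subvs_of sd_cartan, F^o);
  sd_simpleP : simple_roots sd_simple;
  sd_form : sd_lie -> sd_lie -> F;
  sd_formP : invariant_form sd_form }.

Record fps (A : Type) := Fps { fcoef :> nat -> A }.

HB.instance Definition _ (A : Type) := gen_eqMixin (fps A).
HB.instance Definition _ (A : Type) := gen_choiceMixin (fps A).

Lemma fpsP (A : Type) (f g : fps A) : (forall n, f n = g n) -> f = g.
Proof. by case: f g => [f] [g] /= fg; congr Fps; apply/funext. Qed.

Section FpsRing.
Variable A : comNzRingType.
Implicit Types f g h : fps A.

Definition fps_add f g := Fps (fun n => f n + g n).
Definition fps_opp f := Fps (fun n => - f n).
Definition fpsC (a : A) := Fps (fun n => if n is 0 then a else 0).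
Definition fps_mul f g := Fps (fun n => \sum_(i < n.+1) f i * g (n - i)%N).

Fact fps_addA : associative fps_add.
Proof. by move=> f g h; apply: fpsP => n /=; rewrite addrA. Qed.
Fact fps_addC : commutative fps_add.
Proof. by move=> f g; apply: fpsP => n /=; rewrite addrC. Qed.
Fact fps_add0 : left_id (fpsC 0) fps_add.
Proof. by move=> f; apply: fpsP => -[|n] /=; rewrite add0r. Qed.
Fact fps_addN : left_inverse (fpsC 0) fps_opp fps_add.
Proof. by move=> f; apply: fpsP => -[|n] /=; rewrite addNr. Qed.

HB.instance Definition _ := GRing.isZmodule.Build (fps A)
  fps_addA fps_addC fps_add0 fps_addN.

Let trunc N f : {poly A} := \poly_(i < N) f i.

Let coef_trunc_mul N f g n : (n < N)%N ->
  (trunc N f * trunc N g)`_n = fps_mul f g n.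
Proof.
move=> ltnN; rewrite coefM; apply: eq_bigr => i _.
have ltiN : (i < N)%N by apply: leq_ltn_trans ltnN; rewrite -ltnS.
by rewrite !coef_poly ltiN (leq_ltn_trans _ ltnN) ?leq_subr.
Qed.

Fact fps_mulA : associative fps_mul.
Proof.
move=> f g h; apply: fpsP => n.
transitivity ((trunc n.+1 f * (trunc n.+1 g * trunc n.+1 h))`_n).
  rewrite coefM; apply: eq_bigr => i _.
  rewrite coef_poly ltn_ord coef_trunc_mul //.
  by rewrite ltnS leq_subr.
rewrite mulrA coefM; apply: eq_bigr => i _.
by rewrite coef_trunc_mul // coef_poly ltnS leq_subr.
Qed.

Fact fps_mulC : commutative fps_mul.
Proof.
move=> f g; apply: fpsP => n.
by rewrite -!(coef_trunc_mul _ _ (ltnSn n)) mulrC.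
Qed.

Fact fps_mul1 : left_id (fpsC 1) fps_mul.
Proof.
move=> f; apply: fpsP => n /=.
rewrite big_ord_recl /= subn0 mul1r big1 ?addr0 // => i _.
by rewrite mul0r.
Qed.

Fact fps_mulDl : left_distributive fps_mul fps_add.
Proof.
move=> f g h; apply: fpsP => n /=; rewrite -big_split /=.
by apply: eq_bigr => i _; rewrite mulrDl.
Qed.

Fact fps_oner_neq0 : fpsC 1 != fpsC 0 :> fps A.
Proof.
by apply/eqP => /(congr1 (fun f : fps A => f 0)) /= /eqP; rewrite oner_eq0.
Qed.

HB.instance Definition _ := GRing.Zmodule_isComNzRing.Build (fps A)
  fps_mulA fps_mulC fps_mul1 fps_mulDl fps_oner_neq0.

Definition fpsX : fps A := Fps (fun n => (n == 1)%:R).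

(* 1 / (1 - a X) *)
Definition fps_geom (a : A) : fps A := Fps (fun n => a ^+ n).

End FpsRing.

Section FpsExpLog.
Variables (F : fieldType) (A : comAlgType F).

(* Correct for f with zero constant term, when f ^+ k has no terms of order
   less than k; similarly for fps_ln, with constant term one. *)
Definition fps_exp (f : fps A) : fps A :=
  Fps (fun n => \sum_(0 <= k < n.+1) (k`!%:R^-1 : F) *: (f ^+ k) n).

Definition fps_ln (f : fps A) : fps A :=
  Fps (fun n =>
    \sum_(1 <= k < n.+1) ((-1) ^+ k.+1 / k%:R : F) *: ((f - 1) ^+ k) n).

End FpsExpLog.

Record grading (A : comNzRingType) := Grading {
  is_homog : nat -> A -> Prop;
  is_homog0 : forall n, is_homog n 0;
  is_homogB : forall n x y,
    is_homog n x -> is_homog n y -> is_homog n (x - y);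
  is_homog1 : is_homog 0 1;
  is_homogM : forall m n x y,
    is_homog m x -> is_homog n y -> is_homog (m + n) (x * y) }.

Section Completion.
Variables (A : comNzRingType) (gr : grading A).

Definition completion_pred : pred (fps A) :=
  fun x => `[< forall n, is_homog gr n (x n) >].

(* The product of the graded components A_n, with x = \sum_n x_n encoded as
   the series \sum_n x_n T^n. *)
Record completion := Completion {
  cval : fps A; _ : cval \in completion_pred }.

HB.instance Definition _ := [isSub for cval].
HB.instance Definition _ := [Choice of completion by <:].

Fact completion_closed : subring_closed completion_pred.
Proof.
split.
- by apply/asboolP => -[|n]; [exact: is_homog1 | exact: is_homog0].
- move=> x y /asboolP hx /asboolP hy; apply/asboolP => n.
  exact: is_homogB.
- move=> x y /asboolP hx /asboolP hy; apply/asboolP => n.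
  apply: (big_ind (is_homog gr n)) => [|u v hu hv|i _].
  + exact: is_homog0.
  + rewrite -[v]opprK; apply: is_homogB => //.
    by rewrite -sub0r; apply: is_homogB => //; apply: is_homog0.
  + by have := is_homogM (hx i) (hy (n - i)%N); rewrite subnKC // -ltnS.
Qed.

HB.instance Definition _ := GRing.SubChoice_isSubComNzRing.Build
  (fps A) completion_pred completion completion_closed.

End Completion.

(* The exponential of a homogeneous element of degree one. *)
Definition cexp (F : fieldType) (A : comAlgType F) (x : A) : fps A :=
  Fps (fun n => (n`!%:R^-1 : F) *: x ^+ n).

(* monalg's product requires a monoid without units. *)
Definition galg (F : comNzRingType) (G : zmodType) := malg G F.

Section GroupAlgebra.
Variables (F : comNzRingType) (G : zmodType).
Local Notation galg := (galg F G).
Local Notation "g @_ k" := (monalg.mcoeff k g) : ring_scope.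
Local Notation msupp := monalg.msupp.

HB.instance Definition _ := GRing.Lmodule.on galg.

Definition gmon (k : G) : galg := mkmalgU k 1.

Definition galg_mul (g1 g2 : galg) : galg :=
  \sum_(k1 <- msupp g1) \sum_(k2 <- msupp g2)
     (g1@_k1 * g2@_k2) *: gmon (k1 + k2).

Let galgE (g : galg) : g = \sum_(k <- msupp g) g@_k *: gmon k.
Proof.
rewrite [LHS]monalgE; apply: eq_bigr => k _; apply/malgP => l.
by rewrite monalg.mcoeffZ !monalg.mcoeffU mulrnAr mulr1.
Qed.

Let galg_mulw (d1 d2 : {fset G}) (g1 g2 : galg) :
  (msupp g1 `<=` d1)%fset -> (msupp g2 `<=` d2)%fset ->
  galg_mul g1 g2 =
    \sum_(k1 <- d1) \sum_(k2 <- d2) (g1@_k1 * g2@_k2) *: gmon (k1 + k2).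
Proof.
move=> s1 s2; rewrite /galg_mul (big_fset_incl _ s1) /=; last first.
  by move=> k _ /mcoeff_outdom ->; rewrite big1 // => l _; rewrite mul0r scale0r.
apply: eq_bigr => k _; apply: big_fset_incl => // l _ /mcoeff_outdom ->.
by rewrite mulr0 scale0r.
Qed.

Fact galg_mulC : commutative galg_mul.
Proof.
move=> g1 g2; rewrite /galg_mul exchange_big /=.
by apply: eq_bigr => k _; apply: eq_bigr => l _; rewrite mulrC addrC.
Qed.

Fact galg_mulDl : left_distributive galg_mul +%R.
Proof.
move=> g1 g2 g.
rewrite [in RHS](galg_mulw (fsubsetUl _ (msupp g2)) (fsubset_refl _)).
rewrite [in RHS](galg_mulw (fsubsetUr (msupp g1) _) (fsubset_refl _)).
rewrite (galg_mulw (monalg.msuppD_le _ _) (fsubset_refl _)).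
rewrite -big_split /=; apply: eq_bigr => k1 _.
rewrite -big_split /=; apply: eq_bigr => k2 _.
by rewrite monalg.mcoeffD mulrDl scalerDl.
Qed.

Let galg_mulDr : right_distributive galg_mul +%R.
Proof. by move=> f g h; rewrite !(galg_mulC f) galg_mulDl. Qed.

Fact galg_scaleAl c g1 g2 : c *: galg_mul g1 g2 = galg_mul (c *: g1) g2.
Proof.
rewrite (galg_mulw (monalg.msuppZ_le c g1) (fsubset_refl _)) scaler_sumr.
apply: eq_bigr => k1 _; rewrite scaler_sumr; apply: eq_bigr => k2 _.
by rewrite scalerA monalg.mcoeffZ mulrA.
Qed.

Let galg_scaleAr c g1 g2 : c *: galg_mul g1 g2 = galg_mul g1 (c *: g2).
Proof. by rewrite galg_mulC galg_scaleAl galg_mulC. Qed.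

Let galg_mul0 g : galg_mul g 0 = 0.
Proof. by have := galg_scaleAr 0 g 0; rewrite !scale0r. Qed.

Let galg_0mul g : galg_mul 0 g = 0.
Proof. by rewrite galg_mulC galg_mul0. Qed.

Let gmonM k l : galg_mul (gmon k) (gmon l) = gmon (k + l).
Proof.
rewrite (galg_mulw msuppU_le msuppU_le) !big_seq_fset1.
by rewrite !monalg.mcoeffUU mulr1 scale1r.
Qed.

Let mulsl (I : Type) (r : seq I) (E : I -> galg) g :
  galg_mul (\sum_(i <- r) E i) g = \sum_(i <- r) galg_mul (E i) g.
Proof.
exact: (big_morph (galg_mul^~ g) (fun _ _ => galg_mulDl _ _ _) (galg_0mul g)).
Qed.

Let mulsr (I : Type) (r : seq I) (E : I -> galg) g :
  galg_mul g (\sum_(i <- r) E i) = \sum_(i <- r) galg_mul g (E i).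
Proof.
exact: (big_morph (galg_mul g) (fun _ _ => galg_mulDr _ _ _) (galg_mul0 g)).
Qed.

Fact galg_mulA : associative galg_mul.
Proof.
move: mulsl mulsr galg_scaleAl galg_scaleAr gmonM.
move: galg_mul => op sl sr zl zr opM f g h.
rewrite [f]galgE !sl; apply: eq_bigr => i _; rewrite -!zl; congr (_ *: _).
rewrite [g]galgE sl !sr sl; apply: eq_bigr => j _.
rewrite -!(zl, zr); congr (_ *: _).
by rewrite [h]galgE !sr; apply: eq_bigr => k _; rewrite -!zr !opM addrA.
Qed.

Fact galg_mul1 : left_id (gmon 0) galg_mul.
Proof.
move=> g; move: mulsr galg_scaleAr gmonM; move: galg_mul => op sr zr opM.
rewrite [g]galgE sr; apply: eq_bigr => k _.
by rewrite -zr opM add0r.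
Qed.

Fact galg_oner_neq0 : gmon 0 != 0 :> galg.
Proof.
apply/eqP => /(congr1 (monalg.mcoeff 0)).
by rewrite /gmon monalg.mcoeffUU monalg.mcoeff0 => /eqP; rewrite oner_eq0.
Qed.

HB.instance Definition _ := GRing.Zmodule_isComNzRing.Build galg
  galg_mulA galg_mulC galg_mul1 galg_mulDl galg_oner_neq0.
HB.instance Definition _ :=
  GRing.Lmodule_isLalgebra.Build F galg galg_scaleAl.
HB.instance Definition _ := GRing.Lalgebra_isComAlgebra.Build F galg.

Lemma mcoeff_galgM (g1 g2 : galg) k :
  (g1 * g2)@_k = \sum_(l <- msupp g1) g1@_l * g2@_(k - l).
Proof.
rewrite [g1 * g2]/(galg_mul g1 g2) /galg_mul raddf_sum /=.
apply: eq_bigr => l _; rewrite raddf_sum /= [in RHS](galgE g2) raddf_sum /=.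
rewrite mulr_sumr; apply: eq_bigr => l' _.
rewrite !monalg.mcoeffZ !monalg.mcoeffU mulrA; congr (_ * (_ *+ nat_of_bool _)).
by rewrite [RHS]eq_sym subr_eq addrC eq_sym.
Qed.

End GroupAlgebra.

Arguments gmon {F G} k.

Section Rings.
Variable C : fieldType.

(* C[q^{+-1}], with q ^ n = gmon n. *)
Definition qring : Type := galg C int.
HB.instance Definition _ := GRing.ComAlgebra.on qring.

(* The ring U^0_i, over C[q^{+-1}], with H_{i,r} = U0H r. *)
Definition U0 : Type := malg (cmonom int) qring.
HB.instance Definition _ := GRing.ComAlgebra.on U0.

Definition U0C (f : qring) : U0 := mkmalgU mone f.
Definition U0H (r : int) : U0 := mkmalgU (ucm r) 1.

(* Y^0_i as C[hbar, xi_{i,0}, xi_{i,1}, ...]: the variable None is hbar and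
   Some r is xi_{i,r}. *)
Definition Y0 : Type := malg (cmonom (option nat)) C.
HB.instance Definition _ := GRing.ComAlgebra.on Y0.

Definition Y0hbar : Y0 := mkmalgU (ucm None) 1.
Definition Y0xi (r : nat) : Y0 := mkmalgU (ucm (Some r)) 1.

Definition Y0deg (mu : cmonom (option nat)) : nat :=
  (\sum_(v <- finsupp mu) mu v * (if v is Some r then r else 1))%N.

Definition Y0_is_homog (n : nat) (P : Y0) :=
  forall mu, monalg.mcoeff mu P != 0 -> Y0deg mu = n.

Let Y0degEw (mu : cmonom (option nat)) (D : {fset option nat}) :
  (finsupp mu `<=` D)%fset ->
  Y0deg mu = (\sum_(v <- D) mu v * (if v is Some r then r else 1))%N.
Proof.
move=> sD; rewrite /Y0deg (big_fset_incl _ sD) // => v _.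
by rewrite -cmE_neq0 negbK => /eqP ->.
Qed.

Let Y0degM mu nu : Y0deg (mmul mu nu) = (Y0deg mu + Y0deg nu)%N.
Proof.
rewrite {1}/Y0deg mdomD (Y0degEw (fsubsetUl _ (finsupp nu))).
rewrite (Y0degEw (fsubsetUr (finsupp mu) _)) -big_split /=.
by apply: eq_bigr => v _; rewrite cmM mulnDl.
Qed.

Fact Y0_homog0 n : Y0_is_homog n 0.
Proof. by move=> mu; rewrite monalg.mcoeff0 eqxx. Qed.

Fact Y0_homogB n P Q :
  Y0_is_homog n P -> Y0_is_homog n Q -> Y0_is_homog n (P - Q).
Proof.
move=> hP hQ mu; rewrite monalg.mcoeffB.
have [->|/hP //] := eqVneq (monalg.mcoeff mu P) 0.
by rewrite sub0r oppr_eq0 => /hQ.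
Qed.

Fact Y0_homog1 : Y0_is_homog 0 1.
Proof.
move=> mu; rewrite monalg.mcoeff1; have [->|_] := eqVneq mu mone.
  by rewrite /Y0deg mdom1 big_seq_fset0.
by rewrite eqxx.
Qed.

Fact Y0_homogM m n P Q :
  Y0_is_homog m P -> Y0_is_homog n Q -> Y0_is_homog (m + n) (P * Q).
Proof.
move=> hP hQ mu; rewrite monalg.mcoeff_neq0 => /monalg.msuppM_le.
case=> k [l []]; rewrite -!monalg.mcoeff_neq0 => /hP <- /hQ <- ->.
exact: Y0degM.
Qed.

Definition Y0_grading : grading Y0 :=
  Grading Y0_homog0 Y0_homogB Y0_homog1 Y0_homogM.

Definition Y0hat : Type := completion Y0_grading.
HB.instance Definition _ := GRing.ComNzRing.on Y0hat.
HB.instance Definition _ := SubType.on Y0hat.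

Variable m : nat.

(* C[q^{+-1}, A_1^{+-1}, ..., A_m^{+-1}]: the exponent of q, then those of
   the A_p. *)
Definition Laurent : Type := galg C (int * {ffun 'I_m -> int})%type.
HB.instance Definition _ := GRing.ComAlgebra.on Laurent.

Definition Lq (n : int) : Laurent := gmon (n, 0).
Definition LA (p : 'I_m) (r : int) : Laurent :=
  gmon (0, [ffun j => if j == p then r else 0]).

Definition S_pred : pred Laurent := fun P =>
  `[< forall (s : 'S_m) n (e : {ffun 'I_m -> int}),
      monalg.mcoeff (n, [ffun j => e (s j)]) P = monalg.mcoeff (n, e) P >].

Record Sm := MkSm { Sm_val : Laurent; _ : Sm_val \in S_pred }.
HB.instance Definition _ := [isSub for Sm_val].
HB.instance Definition _ := [Choice of Sm by <:].

Let permL (s : 'S_m) (k : int * {ffun 'I_m -> int}) :=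
  (k.1, [ffun j => k.2 (s j)]).

Let permL_inj s : injective (permL s).
Proof.
move=> [n e] [n' e'] [-> /ffunP ee]; congr pair; apply/ffunP => j.
by have := ee (s^-1 j)%g; rewrite !ffunE permKV.
Qed.

Let permLB s k l : permL s (k - l) = permL s k - permL s l.
Proof. by congr pair; apply/ffunP => j; rewrite !ffunE. Qed.

Let S_predP (P : Laurent) : reflect
  (forall s k, monalg.mcoeff (permL s k) P = monalg.mcoeff k P) (P \in S_pred).
Proof.
apply: (iffP idP) => [/asboolP h s [n e]|h]; first exact: h.
by apply/asboolP => s n e; exact: (h s (n, e)).
Qed.

Fact S_closed : subring_closed S_pred.
Proof.
split=> [|P Q /S_predP hP /S_predP hQ|P Q /S_predP hP /S_predP hQ];
  apply/S_predP => s k.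
- have -> : (1 : Laurent) = gmon 0 by [].
  have p0 : permL s 0 = 0 by have := permLB s 0 0; rewrite !subrr.
  rewrite !monalg.mcoeffU; congr (_ *+ nat_of_bool _).
  by rewrite -[X in X == permL s k]p0 (inj_eq (@permL_inj s)).
- by rewrite !monalg.mcoeffB hP hQ.
- rewrite !mcoeff_galgM.
  have -> : \sum_(l <- monalg.msupp P)
        monalg.mcoeff l P * monalg.mcoeff (permL s k - l) Q =
      \sum_(l <- map (permL s) (monalg.msupp P))
        monalg.mcoeff l P * monalg.mcoeff (permL s k - l) Q.
    apply: perm_big; apply: uniq_perm => [||l]; first exact: fset_uniq.
      by rewrite (map_inj_uniq (@permL_inj s)) fset_uniq.
    have -> : l = permL s (permL s^-1%g l).
      case: l => n e; congr pair; apply/ffunP => j.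
      by rewrite !ffunE permK.
    by rewrite (mem_map (@permL_inj s)) -!monalg.mcoeff_neq0 hP.
  rewrite big_map; apply: eq_bigr => l _.
  by rewrite -permLB hP hQ.
Qed.

HB.instance Definition _ := GRing.SubChoice_isSubComNzRing.Build
  Laurent S_pred Sm S_closed.

(* C[hbar, a_1, ..., a_m]: the variable 0 is hbar, and S_m acts on the others. *)
Definition hpoly : Type := {mpoly C[m.+1]}.
HB.instance Definition _ := GRing.ComAlgebra.on hpoly.

Definition Rhbar : hpoly := 'X_ord0.
Definition Ra (p : 'I_m) : hpoly := 'X_(lift ord0 p).

Definition hpoly_grading : grading hpoly.
Proof.
apply: (@Grading hpoly (fun n P => P \is n.-homog)).
- by move=> n; rewrite rpred0.
- by move=> n P Q hP hQ; rewrite rpredB.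
- exact: dhomog1.
- by move=> k n P Q; apply: dhomogM.
Defined.

Definition R_pred : pred hpoly := fun P =>
  [forall s : 'S_m, msym (lift_perm ord0 ord0 s) P == P].

Record Rm := MkRm { Rm_val : hpoly; _ : Rm_val \in R_pred }.
HB.instance Definition _ := [isSub for Rm_val].
HB.instance Definition _ := [Choice of Rm by <:].

Fact R_closed : subring_closed R_pred.
Proof.
split=> [|P Q /forallP hP /forallP hQ|P Q /forallP hP /forallP hQ];
  apply/forallP => s.
- by rewrite rmorph1.
- by rewrite rmorphB /= (eqP (hP s)) (eqP (hQ s)).
- by rewrite rmorphM /= (eqP (hP s)) (eqP (hQ s)).
Qed.

HB.instance Definition _ := GRing.SubChoice_isSubComNzRing.Build
  hpoly R_pred Rm R_closed.

Definition Rm_is_homog (n : nat) (P : Rm) := is_homog hpoly_grading n (val P).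

Fact Rm_homog0 n : Rm_is_homog n 0.
Proof. exact: is_homog0. Qed.
Fact Rm_homogB n P Q :
  Rm_is_homog n P -> Rm_is_homog n Q -> Rm_is_homog n (P - Q).
Proof. exact: is_homogB. Qed.
Fact Rm_homog1 : Rm_is_homog 0 1.
Proof. exact: is_homog1. Qed.
Fact Rm_homogM k n P Q :
  Rm_is_homog k P -> Rm_is_homog n Q -> Rm_is_homog (k + n) (P * Q).
Proof. exact: is_homogM. Qed.

Definition Rm_grading : grading Rm :=
  Grading Rm_homog0 Rm_homogB Rm_homog1 Rm_homogM.

Definition Rmhat : Type := completion Rm_grading.
HB.instance Definition _ := GRing.ComNzRing.on Rmhat.
HB.instance Definition _ := SubType.on Rmhat.

Definition hpolyhat : Type := completion hpoly_grading.
HB.instance Definition _ := GRing.ComNzRing.on hpolyhat.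
HB.instance Definition _ := SubType.on hpolyhat.

Variable d : int.

(* d is d_i, an integer so that q_i = q ^ d lies in C[q^{+-1}].
   psi_i(z) is a series in w = z^{-1} and phi_i(z) a series in z. Since
   D^U(H_{i,0}) = m, exp(hbar d_i/2 H_{i,0}) goes to q_i^m = q^{d_i m}. *)
Definition is_DU (DU : U0 -> Sm) :=
  [/\ forall c : C, val (DU (U0C c%:A)) = c%:A,
      val (DU (U0C (gmon 1))) = Lq 1,
      DU (U0H 0) = m%:R,
      fpsC (Lq (d * m%:Z)) *
        fps_exp (Fps (fun s => if s is 0 then 0
                               else (Lq d - Lq (- d)) * val (DU (U0H s%:Z))))
      = \prod_(p < m) ((fpsC (Lq d) - fpsC (Lq (- d) * LA p 1) * fpsX _)
                       * fps_geom (LA p 1))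
    & fpsC (Lq (- (d * m%:Z))) *
        fps_exp (Fps (fun s => if s is 0 then 0
                               else - (Lq d - Lq (- d)) * val (DU (U0H (- s%:Z)))))
      = \prod_(p < m) ((fpsC (Lq (- d)) - fpsC (Lq d * LA p (- 1)) * fpsX _)
                       * fps_geom (LA p (- 1)))].

(* ch is the restriction to S(m) of a homomorphism on all Laurent
   polynomials, as the A_p are not themselves in S(m). *)
Definition is_ch (ch : Sm -> Rmhat) :=
  exists chL : {rmorphism Laurent -> hpolyhat},
  [/\ forall c : C, val (chL c%:A) = fpsC c%:A,
      val (chL (Lq 1)) = cexp (2%:R^-1 *: Rhbar),
      forall p, val (chL (LA p 1)) = cexp (Ra p)
    & forall P n, val (val (ch P) n) = val (chL (val P)) n].

(* xi_i(u), as a series in u^{-1}. *)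
Definition Y0xi_series : fps Y0 :=
  Fps (fun n => if n is r.+1 then Y0hbar * Y0xi r else 1).

Definition is_t (t : nat -> Y0) :=
  Fps (fun n => if n is r.+1 then Y0hbar * t r else 0) = fps_ln Y0xi_series.

(* q ^ n = exp(n hbar / 2) in the completion. *)
Definition Y0q (n : int) : fps Y0 := cexp ((n%:~R / 2%:R) *: Y0hbar).

(* g is hbar / (q_i - q_i^{-1}); multiplication by q_i - q_i^{-1} is injective
   on power series over Y0 when d != 0, and there is no such g when d = 0. *)
Definition is_Phi0 (t : nat -> Y0) (Phi : U0 -> Y0hat) :=
  [/\ forall c : C, val (Phi (U0C c%:A)) = fpsC c%:A,
      val (Phi (U0C (gmon 1))) = Y0q 1,
      val (Phi (U0H 0)) = fpsC (d%:~R^-1 *: t 0)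
    & exists2 g : fps Y0, g * (Y0q d - Y0q (- d)) = fpsC Y0hbar * fpsX _ &
        forall r : int, r != 0 ->
          val (Phi (U0H r)) = g * Fps (fun k => (r%:~R ^+ k / k`!%:R) *: t k)].

(* (u + d_i hbar - a_p) / (u - a_p) is expanded in u^{-1}. *)
Definition is_DY (DY : Y0 -> Rm) :=
  [/\ forall c : C, val (DY c%:A) = c%:A,
      val (DY Y0hbar) = Rhbar
    & Fps (fun n => val (DY (Y0xi_series n))) =
      \prod_(p < m) ((1 + fpsC (d%:~R *: Rhbar - Ra p) * fpsX _)
                     * fps_geom (Ra p))].

Definition is_DYhat (DY : Y0 -> Rm) (DYhat : Y0hat -> Rmhat) :=
  forall x n, val (DYhat x) n = DY (val x n).

End Rings.

(* Main.v *)
Require Import Defs.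
From mathcomp Require Import all_boot all_order all_algebra.
From mathcomp Require Import finmap reals complex ring.
From mathcomp.multinomials Require Import -(notations) monalg.
From mathcomp.multinomials Require Import mpoly.

Set Implicit Arguments.
Unset Strict Implicit.
Unset Printing Implicit Defensive.

Import Order.TTheory GRing.Theory Num.Theory.

(** Both composites are ring homomorphisms, so it suffices to compare them on
    the constants, on [q] and on the generators [H_{i,r}]. The first two are
    immediate; for [H_{i,r}] neither side is given by a formula, only through
    an exponential or a logarithm of a product, and the idea is to remove those
    by logarithmic derivatives.

    The product [P(w) = \prod_p (1 - b_p w) / (1 - a_p w)] has logarithmic
    derivative [\sum_{n >= 0} \sum_p (a_p^(n+1) - b_p^(n+1)) w^n], whatever
    the commutative ring ([logderiv_prod_frac]). As [exp f = P] gives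
    [f' P = P'] and [f = log P] gives the same relation, in both cases
    [(n+1) f_(n+1)] is the difference of power sums
    [\sum_p (a_p^(n+1) - b_p^(n+1))] ([fps_prod_frac_coef]).

    - For [D^U], both expansions of the product yield, for every [r <> 0],
      [r (q_i - q_i^-1) D^U(H_{i,r}) = \sum_p (A_p^r - q_i^(-2r) A_p^r)]
      ([loop_power_sum]), which [ch] sends to
      [\sum_p (exp(r a_p) - exp(r (a_p - d_i hbar)))] ([exp_power_sum]).
    - For [D^Y], one gets
      [(n+1) hbar D^Y(t_{i,n}) = \sum_p (a_p^(n+1) - (a_p - d_i hbar)^(n+1))]
      ([t_power_sum]); summing against [r^(n+1) / (n+1)!] gives the same
      difference of exponentials for [r (q_i - q_i^-1) D^Y(Phi^0(H_{i,r}))]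
      ([Phi_power_sum]).

    Finally [q_i - q_i^-1] divides [hbar] times the variable that records the
    degree, so it can be cancelled ([fps_divCX_inj]). The same divisibility
    forces [d_i <> 0], which settles [H_{i,0}]: there [n = 0] in the formula
    for [t_{i,n}] reads [hbar D^Y(t_{i,0}) = m d_i hbar]. *)

Local Open Scope ring_scope.

(** * Formal power series and their logarithmic derivatives *)

Section Series.
Variable A : comNzRingType.
Implicit Types (f g h : fps A) (a b : A).

Lemma fps_coefM f g n : (f * g) n = \sum_(i < n.+1) f i * g (n - i)%N.
Proof. by []. Qed.

Lemma fps_coef1 n : (1 : fps A) n = (n == 0%N)%:R.
Proof. by case: n. Qed.

Lemma fps_coefN f n : (- f) n = - f n.
Proof. by []. Qed.

Lemma fps_coefB f g n : (f - g) n = f n - g n.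
Proof. by []. Qed.

Lemma fps_coef_sum (I : Type) (r : seq I) (P : pred I) (E : I -> fps A) n :
  (\sum_(i <- r | P i) E i) n = \sum_(i <- r | P i) E i n.
Proof. by apply: (big_morph (fun f : fps A => f n)) => //; case: n. Qed.

Lemma fps_coefMn f k n : (f *+ k) n = f n *+ k.
Proof. by elim: k => [|k IHk]; [case: n | rewrite !mulrS /= IHk]. Qed.

Lemma fps_coefCM a f n : (fpsC a * f) n = a * f n.
Proof.
rewrite fps_coefM big_ord_recl subn0 big1 ?addr0 // => i _.
by rewrite mul0r.
Qed.

Lemma fps_coefXM f n : (fpsX A * f) n = if n is k.+1 then f k else 0.
Proof.
case: n => [|n]; rewrite fps_coefM big_ord_recl mul0r add0r ?big_ord0 //.
rewrite big_ord_recl mul1r subSS subn0 big1 ?addr0 // => i _.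
by rewrite mul0r.
Qed.

Lemma fpsCM a b : fpsC (a * b) = fpsC a * fpsC b :> fps A.
Proof. by apply: fpsP => -[|n]; rewrite fps_coefCM ?mulr0. Qed.

(** Only the coefficients of the first factor up to order [n] matter; this lets
    a series be replaced by a partial sum before multiplying. *)
Lemma fps_coefM_eql f f' g n :
  (forall i, (i <= n)%N -> f i = f' i) -> (f * g) n = (f' * g) n.
Proof.
by move=> ff'; apply: eq_bigr => i _; rewrite ff' // -ltnS ltn_ord.
Qed.

Lemma fps_coef_low f g k n : f 0%N = 0 -> (n < k)%N -> (f ^+ k * g) n = 0.
Proof.
move=> f0; elim: k n => // k IHk n ltnk.
rewrite exprS -mulrA fps_coefM big_ord_recl f0 mul0r add0r.
rewrite big1 // => i _; rewrite IHk ?mulr0 //.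
apply: leq_trans (_ : (n <= k)%N); last by rewrite -ltnS.
by rewrite ltn_subrL /= (leq_trans _ (ltn_ord i)).
Qed.

Lemma fps_geomK a : (1 - fpsC a * fpsX A) * fps_geom a = 1.
Proof.
apply: fpsP => n; rewrite mulrBl mul1r -mulrA fps_coef1.
rewrite fps_coefB fps_coefCM fps_coefXM.
by case: n => [|n]; rewrite ?mulr0 ?subr0 // -exprS subrr.
Qed.

Definition fps_deriv f : fps A := Fps (fun n => f n.+1 *+ n.+1).

Lemma fps_coef_deriv f n : fps_deriv f n = f n.+1 *+ n.+1.
Proof. by []. Qed.

Lemma fps_derivM f g :
  fps_deriv (f * g) = fps_deriv f * g + f * fps_deriv g.
Proof.
apply: fpsP => n.
rewrite fps_coef_deriv fps_coefM -sumrMnl.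
have -> : \sum_(i < n.+2) f i * g (n.+1 - i)%N *+ n.+1 =
    \sum_(i < n.+2) (f i *+ i) * g (n.+1 - i)%N
    + \sum_(i < n.+2) f i * (g (n.+1 - i)%N *+ (n.+1 - i)).
  rewrite -big_split /=; apply: eq_bigr => i _.
  by rewrite mulrnAl mulrnAr -mulrnDr subnKC // -ltnS ltn_ord.
rewrite big_ord_recl /= mulr0n mul0r add0r.
rewrite [X in _ + X]big_ord_recr /= subnn mulr0n mulr0 addr0.
congr (_ + _); apply: eq_bigr => i _ //=.
by rewrite subSn // -ltnS ltn_ord.
Qed.

Lemma fps_deriv1 : fps_deriv 1 = 0.
Proof. by apply: fpsP => n; rewrite /= mul0rn; case: n. Qed.

Lemma fps_derivX f k : fps_deriv (f ^+ k.+1) = fps_deriv f * f ^+ k *+ k.+1.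
Proof.
elim: k => [|k IHk]; first by rewrite expr1 expr0 mulr1.
rewrite exprS fps_derivM IHk mulrnAr mulrCA -exprS [RHS]mulrS.
by [].
Qed.

Definition logderiv f h := fps_deriv f = h * f.

Lemma logderivM f g hf hg :
  logderiv f hf -> logderiv g hg -> logderiv (f * g) (hf + hg).
Proof.
move=> ef eg.
by rewrite /logderiv fps_derivM ef eg mulrDl -mulrA [f * (_ * _)]mulrCA.
Qed.

Lemma logderiv1 : logderiv 1 0.
Proof. by rewrite /logderiv fps_deriv1 mul0r. Qed.

Definition fps_powers a : fps A := Fps (fun n => a ^+ n.+1).

Lemma logderiv_geom a : logderiv (fps_geom a) (fps_powers a).
Proof.
apply: fpsP => n; rewrite fps_coefM /=.
rewrite (eq_bigr (fun=> a ^+ n.+1)) ?sumr_const ?card_ord // => i _.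
by rewrite -exprD addSn subnKC // -ltnS ltn_ord.
Qed.

(** [1 - b w] is the inverse of the geometric series, hence the sign. *)
Lemma logderiv_linear b : logderiv (1 - fpsC b * fpsX A) (- fps_powers b).
Proof.
have -> : fps_powers b = fpsC b * fps_geom b.
  by apply: fpsP => n; rewrite fps_coefCM /= exprS.
rewrite /logderiv mulNr -mulrA [fps_geom b * _]mulrC fps_geomK mulr1.
apply: fpsP => -[|n]; rewrite fps_coef_deriv fps_coefB fps_coef1 sub0r;
  rewrite fps_coefCM.
  by rewrite mulr1.
by rewrite mulr0 oppr0 mul0rn fps_coefN oppr0.
Qed.

(** The series of [(1 - b w) / (1 - a w)]. *)
Definition fps_frac a b : fps A := (1 - fpsC b * fpsX A) * fps_geom a.

Lemma fps_frac_inv a b : fps_frac a b * fps_frac b a = 1.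
Proof.
by rewrite /fps_frac [X in _ * X]mulrC mulrACA fps_geomK mul1r mulrC fps_geomK.
Qed.

Section Products.
Variables (m : nat) (a b : 'I_m -> A).
Let P := \prod_(p < m) fps_frac (a p) (b p).

(** The product is invertible: exchange the roles of [a] and [b]. *)
Lemma fps_prod_frac_reg f g : f * P = g * P -> f = g.
Proof.
pose Q := \prod_(p < m) fps_frac (b p) (a p).
have PQ : P * Q = 1.
  by rewrite -big_split /=; apply: big1 => p _; apply: fps_frac_inv.
by move=> /(congr1 ( *%R^~ Q)); rewrite -!mulrA PQ !mulr1.
Qed.

Lemma logderiv_prod_frac :
  logderiv P (\sum_(p < m) (fps_powers (a p) - fps_powers (b p))).
Proof.
apply: (big_ind2 logderiv) => [||p _]; [exact: logderiv1 | |].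
  by move=> f hf g hg; apply: logderivM.
by rewrite addrC; apply: logderivM (logderiv_linear _) (logderiv_geom _).
Qed.

End Products.
End Series.

(** * Derivatives of exponential and logarithm *)

Section ExpLog.
Variables (F : numFieldType) (A : comAlgType F).
Implicit Types (f g : fps A).

Lemma fps_coef_exp f n :
  fps_exp f n = \sum_(0 <= k < n.+1) (k`!%:R^-1 : F) *: (f ^+ k) n.
Proof. by []. Qed.

Lemma fps_coef_ln f n : fps_ln f n =
  \sum_(1 <= k < n.+1) ((-1) ^+ k.+1 / k%:R : F) *: ((f - 1) ^+ k) n.
Proof. by []. Qed.

(** Each coefficient of [fps_exp f] is a truncated sum, whose length grows with
    the order. A common length [n.+1] works for all orders up to [n], since
    [f ^+ k] vanishes below order [k]; then the termwise derivative applies. *)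
Lemma fps_deriv_exp f :
  f 0%N = 0 -> fps_deriv (fps_exp f) = fps_deriv f * fps_exp f.
Proof.
move=> f0; apply: fpsP => n.
have expE i : (i <= n)%N ->
    fps_exp f i = \sum_(0 <= k < n.+1) (k`!%:R^-1 : F) *: (f ^+ k) i.
  move=> le_in; rewrite (@big_cat_nat _ _ _ i.+1) //= [X in _ + X]big_nat_cond.
  rewrite [X in _ + X]big1 ?addr0 // => k /andP[/andP[ltik _] _].
  by rewrite -[f ^+ k]mulr1 fps_coef_low ?scaler0.
transitivity (\sum_(0 <= k < n.+1) (k`!%:R^-1 : F) *: (fps_deriv f * f ^+ k) n).
  rewrite fps_coef_deriv fps_coef_exp -sumrMnl big_nat_recl //.
  rewrite expr0 fps_coef1 scaler0 mul0rn add0r; apply: eq_bigr => k _.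
  rewrite scalerMnr -fps_coef_deriv fps_derivX fps_coefMn.
  rewrite -scalerMnr -scaler_nat scalerA; congr (_ *: _).
  by rewrite factS natrM invfM mulVKf ?pnatr_eq0.
rewrite mulrC [RHS](@fps_coefM_eql _ _
  (Fps (fun i => \sum_(0 <= k < n.+1) (k`!%:R^-1 : F) *: (f ^+ k) i))) //.
rewrite [RHS]fps_coefM.
under [RHS]eq_bigr do rewrite /= mulr_suml.
rewrite [RHS]exchange_big; apply: eq_bigr => k _.
rewrite [fps_deriv f * _]mulrC fps_coefM scaler_sumr.
by apply: eq_bigr => i _; rewrite scalerAl.
Qed.

(** With [v = 1 - g], the derivative of [fps_ln g] agrees up to order [n] with
    [g'] times the partial sum of order [n] of [1 / (1 - v) = 1 / g], and the
    error term [v ^+ n.+1] is invisible at order [n]. *)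
Lemma fps_deriv_ln g : g 0%N = 1 -> fps_deriv (fps_ln g) * g = fps_deriv g.
Proof.
move=> g0; pose v := 1 - g.
have v0 : v 0%N = 0 by rewrite fps_coefB fps_coef1 g0 subrr.
have dv : fps_deriv v = - fps_deriv g.
  apply: fpsP => n; rewrite fps_coefN !fps_coef_deriv fps_coefB fps_coef1.
  by rewrite sub0r mulNrn.
have dlnE N i : (i < N)%N ->
    fps_deriv (fps_ln g) i = (fps_deriv g * \sum_(0 <= k < N) v ^+ k) i.
  move=> ltiN; rewrite mulr_sumr fps_coef_sum.
  rewrite (@big_cat_nat _ _ _ i.+1) // [X in _ = _ + X]big_nat_cond.
  rewrite [X in _ = _ + X]big1 ?addr0; last first.
    by move=> k /andP[/andP[ltik _] _]; rewrite mulrC fps_coef_low.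
  rewrite fps_coef_deriv fps_coef_ln -sumrMnl big_add1; apply: eq_bigr => k _.
  have -> : (g - 1) ^+ k.+1 = (-1) ^+ k.+1 * v ^+ k.+1.
    by rewrite -exprMn mulN1r opprB.
  have signC (j : nat) (x : fps A) n :
      ((-1) ^+ j * x) n = ((-1) ^+ j : F) *: x n.
    rewrite -signr_odd -[in RHS]signr_odd; case: (odd j).
      by rewrite !expr1 mulN1r scaleN1r.
    by rewrite !expr0 mul1r scale1r.
  rewrite signC scalerA mulrAC -exprD addSn addnn exprS.
  rewrite -signr_odd odd_double mulr1.
  rewrite scalerMnr -fps_coef_deriv fps_derivX fps_coefMn.
  rewrite -scalerMnr -scaler_nat scalerA mulrCA divff ?pnatr_eq0 //.
  by rewrite mulr1 scaleN1r dv mulNr fps_coefN opprK.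
apply: fpsP => n.
rewrite [LHS](@fps_coefM_eql _ _ (fps_deriv g * \sum_(0 <= k < n.+1) v ^+ k)).
  rewrite -mulrA [_ * g]mulrC.
  have -> : g * (\sum_(0 <= k < n.+1) v ^+ k) = 1 - v ^+ n.+1.
    rewrite -[RHS]opprB subrX1 -mulNr opprB big_mkord; congr (_ * _).
    by rewrite /v opprB addrC subrK.
  rewrite mulrBr mulr1 [_ * v ^+ _]mulrC.
  by rewrite fps_coefB fps_coef_low // subr0.
by move=> i le_in; apply: dlnE.
Qed.

End ExpLog.

Section ProductCoefs.

(** Taken with [f] either a logarithm of the product or an exponent that yields
    it: the hypothesis is all that the two have in common. *)
Lemma fps_prod_frac_coef (A : comNzRingType) (m : nat) (a b : 'I_m -> A)
    (f : fps A) n :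
  fps_deriv f * \prod_(p < m) fps_frac (a p) (b p) =
    fps_deriv (\prod_(p < m) fps_frac (a p) (b p)) ->
  f n.+1 *+ n.+1 = \sum_(p < m) (a p ^+ n.+1 - b p ^+ n.+1).
Proof.
rewrite logderiv_prod_frac => /fps_prod_frac_reg fE.
by rewrite -fps_coef_deriv fE fps_coef_sum.
Qed.

Lemma fpsCX (A : comNzRingType) (a : A) k : fpsC (a ^+ k) = fpsC a ^+ k.
Proof.
elim: k => [|k IHk]; first by rewrite !expr0; apply: fpsP => -[].
by rewrite !exprS fpsCM IHk.
Qed.

Lemma fpsCN (A : comNzRingType) (a : A) : fpsC (- a) = - fpsC a.
Proof. by apply: fpsP => -[|n]; rewrite fps_coefN //= oppr0. Qed.

Lemma fpsC_nat (A : comNzRingType) k : fpsC k%:R = k%:R :> fps A.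
Proof.
apply: fpsP => n; rewrite fps_coefMn fps_coef1; case: n => //= n.
by rewrite mul0rn.
Qed.

(** The factors of [D^U] have constant term [u], a power of [q], not one. As
    [u - v a w = u (1 - v^2 a w)] when [v] is the inverse of [u], the constant
    terms multiply to [u ^+ m], which the prefactor [c] of the exponential
    accounts for. *)
Lemma exp_prod_coef (F : numFieldType) (A : comAlgType F) (m : nat)
    (a : 'I_m -> A) (c u v : A) (f : fps A) :
  fpsC c * fps_exp f =
    \prod_(p < m) ((fpsC u - fpsC (v * a p) * fpsX A) * fps_geom (a p)) ->
  c = u ^+ m -> u * v = 1 -> f 0%N = 0 ->
  forall n,
    f n.+1 *+ n.+1 = \sum_(p < m) (a p ^+ n.+1 - (v ^+ 2 * a p) ^+ n.+1).
Proof.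
move=> expE cE uv1 f0 n; apply: fps_prod_frac_coef.
suff <- : fps_exp f = \prod_(p < m) fps_frac (a p) (v ^+ 2 * a p).
  by rewrite fps_deriv_exp.
have vu1 : fpsC v * fpsC u = 1 by rewrite -fpsCM mulrC uv1.
have vmc : fpsC v ^+ m * fpsC c = 1.
  by rewrite cE fpsCX -exprMn vu1 expr1n.
rewrite -[LHS]mul1r -{1}vmc -mulrA expE.
have -> : fpsC v ^+ m = \prod_(p < m) fpsC v by rewrite prodr_const card_ord.
rewrite -big_split /=; apply: eq_bigr => p _.
by rewrite mulrA mulrBr vu1 mulrA -fpsCM mulrA -expr2.
Qed.

End ProductCoefs.

Section BaseChange.
Variables (A B : comNzRingType) (phi : {rmorphism A -> B}).

Definition fps_map (f : fps A) : fps B := Fps (fun n => phi (f n)).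

Lemma fps_mapM f g : fps_map (f * g) = fps_map f * fps_map g.
Proof.
apply: fpsP => n; rewrite /= rmorph_sum; apply: eq_bigr => i _.
exact: rmorphM.
Qed.

Lemma fps_mapB f g : fps_map (f - g) = fps_map f - fps_map g.
Proof. by apply: fpsP => n; rewrite fps_coefB /= rmorphB. Qed.

Lemma fps_mapC a : fps_map (fpsC a) = fpsC (phi a).
Proof. by apply: fpsP => -[|n] //=; rewrite rmorph0. Qed.

Lemma fps_mapX : fps_map (fpsX A) = fpsX B.
Proof. by apply: fpsP => n /=; rewrite rmorph_nat. Qed.

Lemma fps_map_deriv f : fps_map (fps_deriv f) = fps_deriv (fps_map f).
Proof. by apply: fpsP => n; rewrite /= rmorphMn. Qed.

Lemma fps_map_prod_frac_coef (m : nat) (a b : 'I_m -> B) (f g : fps A) n :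
  fps_deriv f * g = fps_deriv g ->
  fps_map g = \prod_(p < m) fps_frac (a p) (b p) ->
  phi (f n.+1) *+ n.+1 = \sum_(p < m) (a p ^+ n.+1 - b p ^+ n.+1).
Proof.
move=> dfg gE; rewrite -(fps_prod_frac_coef (f := fps_map f)) //.
by rewrite -gE -!fps_map_deriv -fps_mapM dfg.
Qed.

End BaseChange.

(** * Exponentials *)

(** Values at negative integers are inverses, hence determined. *)
Lemma int_morph_ext (S : comNzRingType) (e1 e2 : int -> S) :
  (forall k l, e1 (k + l) = e1 k * e1 l) ->
  (forall k l, e2 (k + l) = e2 k * e2 l) ->
  e1 0 = 1 -> e2 0 = 1 -> e1 1 = e2 1 -> e1 =1 e2.
Proof.
move=> e1D e2D e10 e20 e11.
have eN (n : nat) : e1 n%:Z = e2 n%:Z.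
  by elim: n => [|n IHn]; rewrite ?e10 ?e20 // intS e1D e2D IHn e11.
move=> k; case: (intP k) => [|n|n]; rewrite ?eN //.
rewrite -[LHS]mulr1 -e20 -(subrr n.+1%:Z) e2D mulrA -eN -e1D addNr.
by rewrite e10 mul1r.
Qed.

Lemma int_morphX (S : comNzRingType) (e : int -> S) :
  (forall k l, e (k + l) = e k * e l) -> e 0 = 1 ->
  forall k n, e (k * n%:Z) = e k ^+ n.
Proof.
move=> eD e0 k; elim=> [|n IHn]; first by rewrite mulr0 expr0 e0.
by rewrite intS mulrDr mulr1 eD IHn exprS.
Qed.

Section Exponentials.
Variables (F : numFieldType) (A : comAlgType F).
Implicit Types x y : A.

Lemma cexpE x n : cexp x n = (n`!%:R^-1 : F) *: x ^+ n.
Proof. by []. Qed.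

Lemma cexp0 : cexp (0 : A) = 1.
Proof.
apply: fpsP => n; rewrite cexpE fps_coef1 expr0n.
by case: n => [|n]; rewrite ?invr1 ?scale1r ?scaler0.
Qed.

Lemma cexpD x y : cexp (x + y) = cexp x * cexp y.
Proof.
apply: fpsP => n; rewrite cexpE addrC exprDn scaler_sumr fps_coefM.
apply: eq_bigr => i _; have le_in : (i <= n)%N by rewrite -ltnS.
rewrite !cexpE -scalerAl -scalerAr scalerA [y ^+ _ * _]mulrC.
rewrite -scaler_nat scalerA; congr (_ *: _).
rewrite -(bin_fact le_in) !natrM !invfM mulrC mulVKf //.
by rewrite pnatr_eq0 -lt0n bin_gt0.
Qed.

Lemma cexp_int (S : comNzRingType) (theta : {rmorphism S -> fps A})
    (e : int -> S) x :
  (forall k l, e (k + l) = e k * e l) -> e 0 = 1 ->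
  theta (e 1) = cexp x -> forall k, theta (e k) = cexp (k%:~R *: x).
Proof.
move=> eD e0 e1; apply: int_morph_ext => [k l|k l|||].
- by rewrite eD rmorphM.
- by rewrite intrD scalerDl cexpD.
- by rewrite e0 rmorph1.
- by rewrite scale0r cexp0.
- by rewrite scale1r.
Qed.

End Exponentials.

(** * Both sides of the diagram on the generators *)

(** [Q], [L p] and [h] stand for the powers of [q], those of [A_p], and
    the image of [H_{i,r}] under [D^U]. *)
Section LoopPowerSums.
Variables (F : numFieldType) (A : comAlgType F) (m : nat) (d : int).
Variables (Q : int -> A) (L : 'I_m -> int -> A) (h : int -> A).
Hypotheses (QD : forall k l, Q (k + l) = Q k * Q l) (Q0 : Q 0 = 1).
Hypotheses (LD : forall p k l, L p (k + l) = L p k * L p l).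
Hypothesis L0 : forall p, L p 0 = 1.
Hypothesis psiE :
  fpsC (Q (d * m%:Z)) *
    fps_exp (Fps (fun s => if s is 0 then 0 else (Q d - Q (- d)) * h s%:Z))
  = \prod_(p < m) ((fpsC (Q d) - fpsC (Q (- d) * L p 1) * fpsX _)
                   * fps_geom (L p 1)).
Hypothesis phiE :
  fpsC (Q (- (d * m%:Z))) *
    fps_exp (Fps (fun s => if s is 0 then 0
                           else - (Q d - Q (- d)) * h (- s%:Z)))
  = \prod_(p < m) ((fpsC (Q (- d)) - fpsC (Q d * L p (- 1)) * fpsX _)
                   * fps_geom (L p (- 1))).

(** The series [phi_i] is [psi_i] with [d], [A_p] and [H_{i,r}] replaced by
    [- d], [A_p^-1] and [H_{i,-r}], which turns the formula for [r > 0] into the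
    same formula for [r < 0]. *)
Lemma loop_power_sum (r : int) : r != 0 ->
  ((Q d - Q (- d)) * h r) *~ r =
    \sum_(p < m) (L p r - Q (- (d * 2%:Z * r)) * L p r).
Proof.
have QX := int_morphX QD Q0; have LX p := int_morphX (LD p) (L0 p).
have QV k : Q k * Q (- k) = 1 by rewrite -QD subrr.
case: (intP r) => [//|n _|n _].
  have := exp_prod_coef psiE (QX d m) (QV d) erefl n.
  rewrite /= pmulrn => ->; apply: eq_bigr => p _.
  by rewrite exprMn -exprM -QX -LX mul1r PoszM mulrA !mulNr.
have cE : Q (- (d * m%:Z)) = Q (- d) ^+ m by rewrite -QX mulNr.
have vE : Q (- d) * Q d = 1 by rewrite mulrC.
have := exp_prod_coef phiE cE vE erefl n.
rewrite mulrNz -pmulrn -mulNrn -mulNr => ->; apply: eq_bigr => p _.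
by rewrite exprMn -exprM -QX -LX mulN1r PoszM mulrA mulrN opprK.
Qed.

End LoopPowerSums.

Section Comparison.
Variables (C : numFieldType) (A : comAlgType C) (m : nat) (d : int).
Variables (hb : A) (a : 'I_m -> A).
Local Notation qexp n := (cexp ((n%:~R / 2%:R : C) *: hb)).
Local Notation b p := (a p - (d%:~R : C) *: hb).

(** The common image of [r (q ^ d - q ^ (- d)) H_{i,r}] under the two paths. *)
Definition power_sum_diff (r : int) : fps A :=
  \sum_(p < m) (cexp ((r%:~R : C) *: a p) - cexp ((r%:~R : C) *: b p)).

Lemma exp_power_sum (S : comNzRingType) (theta : {rmorphism S -> fps A})
    (Q : int -> S) (L : 'I_m -> int -> S) (x : S) (r : int) :
  (forall k, theta (Q k) = qexp k) ->
  (forall p k, theta (L p k) = cexp ((k%:~R : C) *: a p)) ->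
  ((Q d - Q (- d)) * x) *~ r =
    \sum_(p < m) (L p r - Q (- (d * 2%:Z * r)) * L p r) ->
  ((qexp d - qexp (- d)) * theta x) *~ r = power_sum_diff r.
Proof.
move=> thQ thL /(congr1 theta); rewrite rmorphMz rmorphM rmorphB !thQ => ->.
rewrite rmorph_sum; apply: eq_bigr => p _.
rewrite rmorphB rmorphM thQ !thL -cexpD; congr (_ - cexp _).
rewrite scalerBr scalerA addrC; congr (_ + _).
by rewrite -scaleNr; congr (_ *: _); field.
Qed.

Lemma t_power_sum (f : {rmorphism Y0 C -> A}) (t : nat -> Y0 C) n :
  is_t t -> f (Y0hbar C) = hb ->
  fps_map f (Y0xi_series C) = \prod_(p < m) fps_frac (a p) (b p) ->
  (hb * f (t n)) *+ n.+1 = \sum_(p < m) (a p ^+ n.+1 - b p ^+ n.+1).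
Proof.
move=> ht fh fxi.
pose T := Fps (fun n => if n is r.+1 then Y0hbar C * t r else 0).
have dT : fps_deriv T * Y0xi_series C = fps_deriv (Y0xi_series C).
  by rewrite /T ht fps_deriv_ln.
rewrite -(fps_map_prod_frac_coef n dT fxi) -fh -rmorphM.
reflexivity.
Qed.

Lemma fps_coefMz (h : fps A) (r : int) n : (h *~ r) n = h n *~ r.
Proof. by case: r => j; rewrite /intmul ?fps_coefN fps_coefMn. Qed.

(** The relation assumed on [g] turns [(q_i - q_i^-1) g] into [hbar] times the
    variable, so the coefficient of order [n.+1] is the one of [t n], and
    the one of order zero vanishes as do the [m] differences [1 - 1]. *)
Lemma Phi_power_sum (f : {rmorphism Y0 C -> A}) (t : nat -> Y0 C)
    (g : fps (Y0 C)) (r : int) :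
  (forall (c : C) x, f (c *: x) = c *: f x) ->
  (forall n, (hb * f (t n)) *+ n.+1 =
    \sum_(p < m) (a p ^+ n.+1 - b p ^+ n.+1)) ->
  fps_map f g * (qexp d - qexp (- d)) = fpsC hb * fpsX A ->
  ((qexp d - qexp (- d)) *
    fps_map f (g * Fps (fun k => ((r%:~R : C) ^+ k / k`!%:R) *: t k))) *~ r
  = power_sum_diff r.
Proof.
move=> fZ ftE gW.
rewrite fps_mapM mulrA [_ * fps_map f g]mulrC gW -mulrA.
apply: fpsP => n; rewrite fps_coefMz fps_coefCM fps_coefXM fps_coef_sum.
case: n => [|n].
  rewrite mulr0 mul0rz big1 // => p _.
  by rewrite fps_coefB !cexpE !expr0 subrr.
rewrite [LHS]/= fZ -scalerAr -scaler_int scalerA.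
under eq_bigr do rewrite fps_coefB !cexpE !exprZn -scalerBr -scalerBr scalerA.
rewrite -scaler_sumr -ftE -scaler_nat scalerA; congr (_ *: _).
rewrite exprS factS natrM; field.
by rewrite nat1r !pnatr_eq0 -lt0n fact_gt0.
Qed.

End Comparison.

(** A divisor of [a w], with [a <> 0] in a domain, is not a zero divisor: after
    multiplication by its cofactor only a shift and [a] are left to cancel. *)
Lemma fps_divCX_inj (A : idomainType) (a : A) (g w f f' : fps A) : a != 0 ->
  g * w = fpsC a * fpsX A -> w * f = w * f' -> f = f'.
Proof.
move=> a0 gw /(congr1 ( *%R g)); rewrite !mulrA gw -!mulrA => E.
apply: fpsP => n; have /(congr1 (fun h : fps A => h n.+1)) := E.
by rewrite !fps_coefCM !fps_coefXM => /(mulfI a0).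
Qed.

(** * Generators of the loop algebra *)

Section Generators.
Variable C : fieldType.

Lemma gmonD (G : zmodType) (k l : G) :
  gmon (k + l) = gmon k * gmon l :> galg C G.
Proof.
apply/malgP => n; rewrite mcoeff_galgM monalg.msuppU oner_eq0 big_seq_fset1.
rewrite !monalg.mcoeffU eqxx mul1r; congr (_ *+ nat_of_bool _).
by rewrite [RHS]eq_sym subr_eq addrC eq_sym.
Qed.

Lemma galg_expand (G : zmodType) (P : galg C G) :
  P = \sum_(k <- monalg.msupp P) (monalg.mcoeff k P)%:A * gmon k.
Proof.
rewrite [LHS]monalgE; apply: eq_bigr => k _; apply/malgP => l.
by rewrite mulr_algl monalg.mcoeffZ !monalg.mcoeffU mulrnAr mulr1.
Qed.

Lemma cmonom_ind (I : choiceType) (K : cmonom I -> Prop) :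
  K mone -> (forall i mu, K mu -> K (mmul (ucm i) mu)) -> forall mu, K mu.
Proof.
move=> K1 KM mu; have [n] := ubnP (monalg.mdeg mu).
elim: n mu => // n IHn mu ltn.
case: (fset_0Vmem (finsupp mu)) => [supp0 | [i mui]].
  suff -> : mu = mone by [].
  by apply/eqP/cmP => i; rewrite cm1; apply/eqP; rewrite cmE_eq0 supp0 in_fset0.
rewrite -cmE_neq0 in mui.
have muE : mu = mmul (ucm i) (divcm mu (ucm i)).
  apply/eqP/cmP => j; rewrite cmM divcmE ucmE subnKC //.
  by case: eqP => // <-; rewrite lt0n.
rewrite muE; apply: KM; apply: IHn.
by move: ltn; rewrite {1}muE monalg.mdegM monalg.mdegU.
Qed.

Lemma U0_mulU k l (c e : qring C) :
  mkmalgU k c * mkmalgU l e = mkmalgU (mmul k l) (c * e) :> U0 C.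
Proof. exact: fgmulUU. Qed.

Lemma U0CM (f g : qring C) : U0C (f * g) = U0C f * U0C g.
Proof. by rewrite /U0C U0_mulU mul1m. Qed.

Lemma U0C_expand (f : qring C) : U0C f =
  \sum_(k <- monalg.msupp f) U0C (monalg.mcoeff k f)%:A * U0C (gmon k).
Proof.
rewrite {1}[f]galg_expand.
rewrite [LHS](raddf_sum (@mkmalgU (cmonom int) (qring C) mone)).
by apply: eq_bigr => k _; apply: U0CM.
Qed.

Lemma U0_monomMl (r : int) mu :
  mkmalgU (mmul (ucm r) mu) 1 = U0H C r * mkmalgU mu 1 :> U0 C.
Proof. by rewrite /U0H U0_mulU mulr1. Qed.

Lemma U0_term mu (f : qring C) :
  mkmalgU mu f = U0C f * mkmalgU mu 1 :> U0 C.
Proof. by rewrite /U0C U0_mulU mul1m mulr1. Qed.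

(** The image of [q^-1] is the inverse of that of [q], so a homomorphism is
    determined on Laurent polynomials in [q], hence on the polynomial ring over
    them, by its values on the constants, [q] and the variables. *)
Lemma U0_rmorph_ext (S : comNzRingType) (F1 F2 : {rmorphism U0 C -> S}) :
  (forall c : C, F1 (U0C c%:A) = F2 (U0C c%:A)) ->
  F1 (U0C (gmon 1)) = F2 (U0C (gmon 1)) ->
  (forall r, F1 (U0H C r) = F2 (U0H C r)) -> F1 =1 F2.
Proof.
move=> FC Fq FH.
have gD (F : {rmorphism U0 C -> S}) k l :
    F (U0C (gmon (k + l))) = F (U0C (gmon k)) * F (U0C (gmon l)).
  by rewrite gmonD U0CM rmorphM.
have g0 (F : {rmorphism U0 C -> S}) : F (U0C (gmon 0)) = 1.
  exact: (rmorph1 F).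
have Fg : (fun k => F1 (U0C (gmon k))) =1 (fun k => F2 (U0C (gmon k))).
  exact: int_morph_ext (gD F1) (gD F2) (g0 F1) (g0 F2) Fq.
have FU f : F1 (U0C f) = F2 (U0C f).
  rewrite U0C_expand (rmorph_sum F1) (rmorph_sum F2); apply: eq_bigr => k _.
  rewrite (rmorphM F1) (rmorphM F2); congr (_ * _); [exact: FC | exact: Fg].
have FM mu : F1 (mkmalgU mu 1) = F2 (mkmalgU mu 1).
  elim/cmonom_ind: mu => [|r mu IHmu]; first exact: FU 1.
  rewrite U0_monomMl (rmorphM F1) (rmorphM F2).
  by congr (_ * _); [exact: FH | exact: IHmu].
move=> P; rewrite [P]monalgE (rmorph_sum F1) (rmorph_sum F2).
apply: eq_bigr => mu _; rewrite U0_term (rmorphM F1) (rmorphM F2).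
by congr (_ * _); [exact: FU | exact: FM].
Qed.

End Generators.

(** * Commutativity of the diagram *)

Section Diagram.
Variables (C : numFieldType) (m : nat) (d : int).

Lemma LqD k l : Lq C m (k + l) = Lq C m k * Lq C m l.
Proof. by rewrite /Lq -gmonD; congr gmon; congr pair; rewrite /= addr0. Qed.

Lemma Lq0 : Lq C m 0 = 1.
Proof. by []. Qed.

Lemma LAD (p : 'I_m) k l : LA C p (k + l) = LA C p k * LA C p l.
Proof.
rewrite /LA -gmonD; congr gmon; congr pair; apply/ffunP => j.
by rewrite !ffunE; case: eqP => // _; rewrite addr0.
Qed.

Lemma LA0 (p : 'I_m) : LA C p 0 = 1.
Proof.
rewrite /LA -[RHS]/(gmon 0); congr gmon; congr pair; apply/ffunP => j.
by rewrite !ffunE; case: eqP.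
Qed.

Lemma Rmhat_eqP (x y : Rmhat C m) :
  (forall n, val (val x n) = val (val y n)) -> x = y.
Proof. by move=> xy; apply/val_inj/fpsP => n; apply: val_inj. Qed.

Local Notation hb := (Rhbar C m).

Lemma diagram_commutes (t : nat -> Y0 C)
    (DU : {rmorphism U0 C -> Sm C m}) (ch : {rmorphism Sm C m -> Rmhat C m})
    (Phi : {rmorphism U0 C -> Y0hat C}) (DY : {rmorphism Y0 C -> Rm C m})
    (DYhat : {rmorphism Y0hat C -> Rmhat C m}) :
  is_t t -> is_DU d DU -> is_ch ch -> is_Phi0 d t Phi -> is_DY d DY ->
  is_DYhat DY DYhat -> ch \o DU =1 DYhat \o Phi.
Proof.
move=> ht [DUc DUq DU0 psiE phiE] hch [Phic Phiq Phi0 [g gW PhiH]] hDY hDYhat.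
(* Coefficients in both completions are compared as arbitrary polynomials, the
   symmetry under permutations being forgotten by [theta] and [f]. *)
have [theta [thc thq thA chE]] :
    exists theta : {rmorphism Laurent C m -> fps (hpoly C m)},
    [/\ forall c : C, theta c%:A = fpsC c%:A,
        theta (Lq C m 1) = cexp (2%:R^-1 *: hb),
        forall p, theta (LA C p 1) = cexp (Ra C p)
      & forall P n, val (val (ch P) n) = theta (val P) n].
  case: hch => chL [chLc chLq chLA chE]; exists (val \o chL).
  by split; [exact: chLc | exact: chLq | exact: chLA | exact: chE].
have [f [fc fh fxi DYhatE]] : exists f : {rmorphism Y0 C -> hpoly C m},
    [/\ forall c : C, f c%:A = c%:A, f (Y0hbar C) = hb,
        fps_map f (Y0xi_series C) =
          \prod_(p < m) fps_frac (Ra C p) (Ra C p - (d%:~R : C) *: hb)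
      & forall x n, val (val (DYhat x) n) = f (val x n)].
  case: hDY => DYc DYh DYxi; exists (val \o DY).
  split; [exact: DYc | exact: DYh | | ].
    rewrite [LHS]DYxi; apply: eq_bigr => p _.
    by rewrite /fps_frac -(opprB (Ra C p)) fpsCN mulNr.
  by move=> x n; rewrite hDYhat.
have fZ (c : C) x : f (c *: x) = c *: f x.
  by rewrite -mulr_algl rmorphM fc mulr_algl.
have hb0 : hb != 0 by rewrite -msize_poly_eq0 msizeX.
have fq n : fps_map f (Y0q C n) = cexp ((n%:~R / 2%:R : C) *: hb).
  by apply: fpsP => k; rewrite /= fZ rmorphXn fZ fh.
have {}gW : fps_map f g * (cexp ((d%:~R / 2%:R : C) *: hb)
    - cexp (((- d)%:~R / 2%:R : C) *: hb)) = fpsC hb * fpsX _.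
  by rewrite -!fq -fps_mapB -fps_mapM gW fps_mapM fps_mapC fps_mapX fh.
(* If [d] were zero, [gW] would read [0 = hbar w]. *)
have d0 : d%:~R != 0 :> C.
  apply: contra_neq hb0 => d0.
  have := congr1 (fun h : fps (hpoly C m) => h 1%N) gW.
  by rewrite mulrNz d0 oppr0 subrr mulr0 fps_coefCM mulr1.
have ft n := t_power_sum n ht fh fxi.
have coordP u : (forall n, theta (val (DU u)) n = f (val (Phi u) n)) ->
    ch (DU u) = DYhat (Phi u).
  by move=> E; apply: Rmhat_eqP => n; rewrite chE DYhatE; apply: E.
apply: (U0_rmorph_ext (F1 := ch \o DU) (F2 := DYhat \o Phi)) => [c||r];
  apply: coordP => n.
- by rewrite DUc Phic thc; case: n => [|n]; rewrite /= ?fc ?rmorph0.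
- rewrite DUq Phiq thq -[RHS]/(fps_map f (Y0q C 1) n) fq.
  by rewrite mul1r.
have [->|r0] := eqVneq r 0.
  rewrite DU0 Phi0 !rmorph_nat.
  have t0 : f (t 0%N) = (m%:R * d%:~R : C)%:A.
    apply: (mulfI hb0); rewrite -[LHS]mulr1n ft.
    under eq_bigr do rewrite !expr1 opprB addrC subrK.
    by rewrite sumr_const card_ord -scaler_nat scalerA mulr_algr.
  rewrite -[RHS]/(fps_map f (fpsC (d%:~R^-1 *: t 0%N)) n) fps_mapC fZ t0.
  by rewrite scalerA mulrC mulfK // scaler_nat fpsC_nat.
rewrite -[RHS]/(fps_map f (val (Phi (U0H C r))) n); congr (fcoef _ n).
have thQ k : theta (Lq C m k) = cexp ((k%:~R / 2%:R : C) *: hb).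
  by rewrite (cexp_int LqD Lq0 thq) scalerA.
have thL p k : theta (LA C p k) = cexp ((k%:~R : C) *: Ra C p).
  exact: (cexp_int (@LAD p) (LA0 p) (thA p)).
have DUE := loop_power_sum (h := fun r => val (DU (U0H C r)))
  LqD Lq0 LAD LA0 psiE phiE r0.
have UE := exp_power_sum thQ thL DUE.
have YE := Phi_power_sum r fZ ft gW.
apply: (fps_divCX_inj hb0 gW).
have rz : r%:~R != 0 :> C by rewrite intr_eq0.
apply: fpsP => k; apply: (scalerI rz); rewrite !scaler_int -!fps_coefMz.
by rewrite UE PhiH // YE.
Qed.

End Diagram.

Theorem corollary4p5 (R : realType) (g : semisimpleData R[i])
    (i : sd_index g) (d : int)
    (hd : half_sqnorm (@sd_form _ g) (sd_simple i) d%:~R)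
    (m : nat) (hm : (1 <= m)%N)
    (t : nat -> Y0 R[i]) (ht : is_t t)
    (DU : {rmorphism U0 R[i] -> Sm R[i] m}) (hDU : is_DU d DU)
    (ch : {rmorphism Sm R[i] m -> Rmhat R[i] m}) (hch : is_ch ch)
    (Phi : {rmorphism U0 R[i] -> Y0hat R[i]}) (hPhi : is_Phi0 d t Phi)
    (DY : {rmorphism Y0 R[i] -> Rm R[i] m}) (hDY : is_DY d DY)
    (DYhat : {rmorphism Y0hat R[i] -> Rmhat R[i] m})
    (hDYhat : is_DYhat DY DYhat) :
  ch \o DU =1 DYhat \o Phi.
Proof. exact: (diagram_commutes ht hDU hch hPhi hDY hDYhat). Qed.
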